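(* If $G$ is a connected planar graph, then $\mathrm{capt}_3(G)\le (\mathrm{diam}(G)+1)\,|V(G)|$.
   Context: Graphs are finite, undirected and reflexive. The game of Cops and Robbers: cops choose starting vertices (round 0), then the robber; players alternate, cops (any subset) moving to adjacent vertices or staying put, then the robber moving or staying; cops win by occupying the robber's vertex. Three cops suffice to win on any connected planar graph. $\mathrm{capt}_3(G)$ is the minimum over 3-cop strategies of the number of rounds (excluding round 0) until capture against an optimally evading robber. $\mathrm{diam}(G)$ is the diameter. *)

(* Defs.v *)
From HB Require Import structures.
From mathcomp Require Import all_boot all_order all_algebra.
From mathcomp Require Import all_classical all_reals all_analysis.

Set Implicit Arguments.
Unset Strict Implicit.
Unset Printing Implicit Defensive.

Import Order.TTheory GRing.Theory Num.Theory.
Import numFieldNormedType.Exports.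

Local Open Scope classical_set_scope.

(* A finite graph is a symmetric and reflexive relation e on a finType T. *)

Definition graph_connected (T : finType) (e : rel T) : Prop :=
  0 < #|T| /\ forall x y : T, connect e x y.

Definition has_walk (T : finType) (e : rel T) (x y : T) (n : nat) : bool :=
  [exists p : n.-tuple T, path e x p && (last x p == y)].

(* Least length of a walk from x to y; the value is #|T| when y cannot be     *)
(* reached from x (otherwise some walk has length less than #|T|).            *)
Definition dist (T : finType) (e : rel T) (x y : T) : nat :=
  find (has_walk e x y) (iota 0 #|T|).

Definition diam (T : finType) (e : rel T) : nat :=
  \max_(x : T) \max_(y : T) dist e x y.

Definition simple_arc (R : realType) (A : set (R * R)) (a b : R * R) : Prop :=
  exists g : R -> R * R,
    [/\ {within `[0%R, 1%R], continuous g},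
        {in `[0%R, 1%R] &, injective g},
        g 0%R = a, g 1%R = b & A = g @` `[0%R, 1%R]].

(* A drawing in the plane R * R without crossings. Loops are not drawn: they  *)
(* only encode the possibility to stay put, and could always be added to a    *)
(* drawing as small closed curves. The condition on perm_eq says that uv and  *)
(* xy are different as undirected edges.                                      *)
Definition planar (R : realType) (T : finType) (e : rel T) : Prop :=
  exists (pos : T -> R * R) (curve : T -> T -> set (R * R)),
    [/\ injective pos,
        forall u v, curve u v = curve v u,
        forall u v, e u v -> u != v -> simple_arc (curve u v) (pos u) (pos v),
        forall u v w, e u v -> u != v -> curve u v (pos w) ->
          w \in [:: u; v]
      & forall u v x y, e u v -> u != v -> e x y -> x != y ->
          ~~ perm_eq [:: u; v] [:: x; y] ->
          forall z, curve u v z -> curve x y z ->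
          exists w, [/\ w \in [:: u; v], w \in [:: x; y] & z = pos w]].

(* A strategy for k cops maps the positions [:: r_0; ...; r_(t-1)] of the     *)
(* robber at the end of rounds 0, ..., t-1 to the positions of the cops after *)
(* their move of round t; its value at [::] is the placement of round 0.      *)
Definition strategy (k : nat) (T : finType) : Type := seq T -> 'I_k -> T.

(* Requiring legal moves also after sequences that are not walks of the       *)
(* robber is no restriction, since the cops may stay put there.               *)
Definition legal_strategy (k : nat) (T : finType) (e : rel T)
    (s : strategy k T) : Prop :=
  forall (h : seq T) (r : T) (i : 'I_k), e (s h i) (s (rcons h r) i).

Definition robber_walk (T : finType) (e : rel T) (rho : nat -> T) : Prop :=
  forall t, e (rho t) (rho t.+1).

Definition cops_at (k : nat) (T : finType) (s : strategy k T)
    (rho : nat -> T) (t : nat) : 'I_k -> T :=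
  s (mkseq rho t).

(* In round t > 0 the robber is caught either by the move of the cops, while  *)
(* he stands at rho t.-1, or by his own move to rho t. In round 0 only the    *)
(* second case makes sense.                                                   *)
Definition caught_in_round (k : nat) (T : finType) (s : strategy k T)
    (rho : nat -> T) (t : nat) : Prop :=
  (0 < t /\ exists i, cops_at s rho t i = rho t.-1) \/
  (exists i, cops_at s rho t i = rho t).

Definition captures_within (k : nat) (T : finType) (e : rel T)
    (s : strategy k T) (n : nat) : Prop :=
  forall rho, robber_walk e rho ->
    exists2 t, t <= n & caught_in_round s rho t.

(* is_capt k e m means that capt_k is finite and equal to m. A strategy of    *)
(* the cops being deterministic, an optimal robber does as well as the best   *)
(* of all walks rho, so captures_within s n bounds the length of the game.    *)
Definition is_capt (k : nat) (T : finType) (e : rel T) (m : nat) : Prop :=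
  (exists2 s : strategy k T, legal_strategy e s & captures_within e s m) /\
  (forall (s : strategy k T) (n : nat),
     legal_strategy e s -> captures_within e s n -> m <= n).

(* Main.v *)
(** The robber's territory C is a connected set whose outside neighbours lie on two
    disjoint paths P1 and P2, each guarded by a cop. If the ends x and y of P1 are both
    adjacent to C, the third cop takes over a geodesic Q of C joining neighbours of x and y,
    by following the projection of the robber onto Q. In the new territory, a component of
    C - Q, the robber cannot reach all of Q, the interior of P1 and P2: these three
    sets (the last one enlarged by the outside of C) and the three sets C - Q, {x}, {y} would
    form a K33 minor. So one of the cops is released. Gaining control of Q takes at most
    diam + |Q| rounds, which is at most (diam + 1) |Q|, and the paths Q are disjoint.

    That a planar graph has no K33 minor is proved by counting modulo 2: edges are replaced by
    fine polygons, and for two disjoint polygons the number of turns of p - q vanishes when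
    (p, q) goes around the boundary of their product. *)
Require Import Defs.
From Stdlib Require Import Btauto.
From mathcomp Require Import all_boot all_order all_algebra.
From mathcomp Require Import zify lra.

Set Implicit Arguments.
Unset Strict Implicit.
Unset Printing Implicit Defensive.

Import Order.TTheory GRing.Theory Num.Theory.

(** * Connected sets and minors *)

Section Conn.
Variables (T : finType) (e : rel T).
Hypothesis e_sym : symmetric e.
Implicit Types (A B : {set T}) (x y : T).

Definition rel_in A : rel T := [rel u v | [&& u \in A, v \in A & e u v]].

Definition conn A := forall x y, x \in A -> y \in A -> connect (rel_in A) x y.

Definition adj A B := exists x y, [/\ x \in A, y \in B & e x y].

(** The branch sets are indexed by [nat], with only the indices below 3 relevant. [conn] alone would
    allow an empty set; [adj] makes them nonempty. *)
Definition K33_minor_free : Prop := forall A B : nat -> {set T},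
  (forall i, i < 3 -> conn (A i)) -> (forall j, j < 3 -> conn (B j)) ->
  (forall i j, i < 3 -> j < 3 -> adj (A i) (B j)) ->
  (forall i k, i < k < 3 -> [disjoint A i & A k]) ->
  (forall j l, j < l < 3 -> [disjoint B j & B l]) ->
  (forall i j, i < 3 -> j < 3 -> [disjoint A i & B j]) ->
  False.

Lemma rel_in_sub A B : A \subset B -> subrel (connect (rel_in A)) (connect (rel_in B)).
Proof.
move=> /subsetP sAB; apply: connect_sub => x y /and3P[xA yA exy].
by apply: connect1; rewrite /rel_in /= !sAB.
Qed.

Lemma adj_sym A B : adj A B -> adj B A.
Proof. by move=> [x [y [xA yB exy]]]; exists y, x; rewrite e_sym. Qed.

Lemma adjS A A' B B' : A \subset A' -> B \subset B' -> adj A B -> adj A' B'.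
Proof.
move=> /subsetP sA /subsetP sB [x [y [xA yB exy]]].
by exists x, y; split; [exact: sA | exact: sB|].
Qed.

Lemma connU A B : conn A -> conn B -> adj A B -> conn (A :|: B).
Proof.
move=> cA cB [x [y [xA yB exy]]].
have csym : connect_sym (rel_in (A :|: B)).
  by apply: sym_connect_sym => u v; rewrite /rel_in /= e_sym andbCA.
have toy u : u \in A :|: B -> connect (rel_in (A :|: B)) u y.
  rewrite inE => /orP[uA|uB]; last first.
    exact: rel_in_sub (subsetUr _ _) _ _ (cB _ _ uB yB).
  apply: connect_trans (rel_in_sub (subsetUl A B) (cA _ _ uA xA)) _.
  by apply: connect1; rewrite /rel_in /= !inE xA yB orbT.
by move=> u v /toy uy /toy; rewrite csym; apply: connect_trans.
Qed.

Lemma conn1 x : conn [set x].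
Proof. by move=> u v; rewrite !inE => /eqP-> /eqP->. Qed.

Lemma conn_path x p : path e x p -> conn [set u in x :: p].
Proof.
elim: p x => [|y p IHp] x /=.
  by move=> _ u v; rewrite !inE => /eqP-> /eqP->.
move=> /andP[exy pyp]; rewrite set_cons; apply: connU; [exact: conn1|exact: IHp|].
by exists x, y; rewrite !inE !eqxx.
Qed.

(** Realizes an edge of a minor by a walk between chosen representatives of two branch sets. *)
Lemma conn_walk A B a b : conn A -> conn B -> adj A B -> a \in A -> b \in B ->
  exists2 p, path e a p /\ last a p = b & {subset a :: p <= A :|: B}.
Proof.
move=> cA cB AB aA bB; have /connectP[p pp ->] : connect (rel_in (A :|: B)) a b.
  by apply: connU => //; rewrite inE ?aA ?bB ?orbT.
exists p; first by split=> //; apply: sub_path pp => u v /and3P[].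
have {bB} : a \in A :|: B by rewrite inE aA.
elim: p {aA} a pp => [|y p IHp] a /=; first by move=> _ aAB u; rewrite inE => /eqP->.
move=> /andP[/and3P[aAB yAB _] pp] _ u; rewrite inE => /orP[/eqP->//|].
exact: IHp.
Qed.

End Conn.

(** * Winning positions and strategies *)

Section Game.
Variables (k : nat) (T : finType) (e : rel T).
Hypothesis e_refl : reflexive e.
Implicit Types (c : {ffun 'I_k -> T}) (r : T) (n : nat).

Definition caught c r := [exists i, c i == r].

(* The cops, at c and to move, can capture a robber at r in n rounds. *)
Fixpoint win n c r : bool :=
  caught c r || if n is n'.+1 then
    [exists c' : {ffun 'I_k -> T}, [forall i, e (c i) (c' i)] &&
       (caught c' r || [forall r', e r r' ==> win n' c' r'])]
  else false.

Lemma win_step n c c' r : (forall i, e (c i) (c' i)) ->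
  (forall r', e r r' -> win n c' r') -> win n.+1 c r.
Proof.
move=> cc' wc'; apply/orP; right; apply/existsP; exists c'; apply/andP; split.
  exact/forallP.
by apply/orP; right; apply/forallP => r'; apply/implyP/wc'.
Qed.

Lemma win_strike n c r i : 0 < n -> e (c i) r -> win n c r.
Proof.
case: n => // n _ cr; apply/orP; right; apply/existsP.
exists [ffun j => if j == i then r else c j]; apply/andP; split.
  by apply/forallP => j; rewrite ffunE; case: eqP => [->|_].
by apply/orP; left; apply/existsP; exists i; rewrite ffunE eqxx.
Qed.

Lemma winS n c r : win n c r -> win n.+1 c r.
Proof.
elim: n c r => [|n IHn] c r; first by rewrite /= orbF => ->.
move=> /orP[cr|/existsP[c' /andP[/forallP cc' /orP[c'r|/forallP wc']]]].
- by apply/orP; left.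
- by apply/orP; right; apply/existsP; exists c'; rewrite c'r andbT; apply/forallP.
- by apply: (win_step cc') => r' rr'; apply: IHn; move/implyP: (wc' r'); apply.
Qed.

Lemma win_leq m n c r : m <= n -> win m c r -> win n c r.
Proof.
move=> /subnK <-; elim: (n - m) => [|d IHd] // /IHd; exact: winS.
Qed.

(** A winning move when [n] rounds are left, hence [n.-1] after it. If there is none, the cops stay
    at [c], which is legal by reflexivity. *)
Definition next n c r : {ffun 'I_k -> T} :=
  odflt c [pick c' : {ffun 'I_k -> T} | [forall i, e (c i) (c' i)] &&
       (caught c' r || [forall r', e r r' ==> win n.-1 c' r'])].

Definition play N c0 (h : seq T) : nat * {ffun 'I_k -> T} :=
  foldl (fun nc r => (nc.1.-1, next nc.1 nc.2 r)) (N, c0) h.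

Lemma play_rcons N c0 h r : play N c0 (rcons h r) =
  ((play N c0 h).1.-1, next (play N c0 h).1 (play N c0 h).2 r).
Proof. by rewrite /play foldl_rcons. Qed.

Lemma win_strategy N c0 : (forall r, win N c0 r) ->
  exists2 s : strategy k T, legal_strategy e s & captures_within e s N.
Proof.
move=> wN; exists (fun h => (play N c0 h).2).
  move=> h r i; rewrite play_rcons /= /next; case: pickP => //= c' /andP[/forallP cc' _].
  exact: cc'.
move=> rho rhoP.
pose cau t := caught_in_round (fun h => (play N c0 h).2 : 'I_k -> T) rho t.
have play1 t : (play N c0 (mkseq rho t)).1 = N - t.
  elim: t => [|t IHt]; first by rewrite subn0.
  by rewrite mkseqS play_rcons /= IHt subnS.
(* Invariant: unless a capture occurs by round N, the position after round t is won in the N - t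
   remaining rounds. *)
have inv t : t <= N -> (exists2 t', t' <= N & cau t') \/
    win (N - t) (play N c0 (mkseq rho t)).2 (rho t).
  elim: t => [|t IHt] tN; first by right; rewrite subn0.
  have [|] := IHt (ltnW tN); first by left.
  have -> : N - t = (N - t.+1).+1 by rewrite subnSK.
  move=> /orP[/existsP[i /eqP ci]|wt].
    by left; exists t; [exact: ltnW|right; exists i].
  have := play_rcons N c0 (mkseq rho t) (rho t); rewrite -mkseqS play1 /next.
  case: pickP => [c' /andP[_ hc'] /= playS|no]; last first.
    by case/existsP: wt => c' hc'; have := no c'; rewrite -subnS hc'.
  have [/existsP[i /eqP c'i]|/forallP/(_ (rho t.+1))/implyP wc'] := orP hc'.
    (* A cop reaches the robber while he still stands at [rho t], which counts as round t + 1. *)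
    left; exists t.+1 => //; left; split=> //.
    by exists i; rewrite /cops_at playS.
  by right; rewrite playS subnS; apply: wc'; exact: rhoP.
have [//|] := inv N (leqnn N); rewrite subnn /= orbF => /existsP[i /eqP ci].
by exists N => //; right; exists i.
Qed.

End Game.

Arguments win : simpl never.

(** * Territories *)

Section Component.
Variables (T : finType) (e : rel T).
Hypothesis e_sym : symmetric e.
Implicit Types (A C : {set T}) (x y r : T).

Definition component A r : {set T} := [set u | connect (rel_in e A) r u].

Lemma component_refl A r : r \in component A r.
Proof. by rewrite inE connect0. Qed.

Lemma component_sub A r : r \in A -> component A r \subset A.
Proof.
move=> rA; apply/subsetP => u; rewrite inE => /connectP[p].
elim/last_ind: p => [|p v _] /=; first by move=> _ ->.
by rewrite rcons_path last_rcons => /andP[_ /and3P[_ vA _]] ->.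
Qed.

Lemma component_closed A r u v : r \in A ->
  u \in component A r -> v \in A -> e u v -> v \in component A r.
Proof.
move=> rA uC vA euv; have uA := subsetP (component_sub rA) _ uC.
move: uC; rewrite !inE => uC; apply: connect_trans uC (connect1 _).
exact/and3P.
Qed.

Lemma component_conn A r : r \in A -> conn e (component A r).
Proof.
move=> rA; set C := component A r.
have csym : connect_sym (rel_in e C).
  by apply: sym_connect_sym => u v; rewrite /rel_in /= e_sym andbCA.
(* A path from [r] inside [A] never leaves the component. *)
have fromr u : u \in C -> connect (rel_in e C) r u.
  rewrite inE => /connectP[p]; elim/last_ind: p u => [|p v IHp] u /=.
    by move=> _ ->; exact: connect0.
  rewrite rcons_path last_rcons => /andP[pp /and3P[lA vA elv]] ->.
  have lC : last r p \in C by rewrite inE; apply/connectP; exists p.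
  apply: connect_trans (IHp _ pp erefl) (connect1 _); apply/and3P; split=> //.
  exact: component_closed lC vA elv.
by move=> u v /fromr + /fromr; rewrite csym; apply: connect_trans.
Qed.

Lemma conn_exit A C : conn e C -> A \subset C -> A != set0 -> ~~ (C \subset A) ->
  exists u v, [/\ u \in A, v \in C :\: A & e u v].
Proof.
move=> cC AC /set0Pn[a aA] /subsetPn[b bC bA].
have /connectP[p pp lb] := cC a b (subsetP AC _ aA) bC.
elim: p a aA pp lb => [|v p IHp] a aA /=; first by move=> _ ba; move: bA; rewrite ba aA.
move=> /andP[/and3P[_ vC eav] pp] lb; have [vA|vA] := boolP (v \in A).
  exact: IHp vA pp lb.
by exists a, v; rewrite inE vA.
Qed.

End Component.

(** * Guarded paths around a territory, and geodesics through it *)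

Section Territory.
Variables (T : finType) (e : rel T).
Hypotheses (e_sym : symmetric e) (e_refl : reflexive e).
Implicit Types (C W : {set T}) (P Q : seq T) (x y r : T).

(* A cop who answers a robber at r by moving to s r can keep doing so while the robber stays *)
(* in C, and captures him as soon as he enters P. *)
Definition guard C (s : T -> T) P : Prop :=
  (forall r r', r \in C -> r' \in C -> e r r' -> e (s r) (s r')) /\
  (forall r p, r \in C -> p \in P -> e r p -> e (s r) p).

Lemma guardS C C' s P P' : C' \subset C -> {subset P' <= P} -> guard C s P -> guard C' s P'.
Proof.
move=> /subsetP sC sP [g1 g2]; split=> [r r' /sC rC /sC|r p /sC rC /sP]; [exact: g1|exact: g2].
Qed.

(* W witnesses that P' and the part of the graph beyond P and P' can be contracted to one *)
(* branch set adjacent to both ends of P. *)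
Definition link C P P' : Prop := P' != [::] -> forall x m y, P = x :: rcons m y ->
  exists W, [/\ conn e W, {subset P' <= W}, forall u, u \in W -> u \notin C /\ u \notin P,
    adj e W [set x] & adj e W [set y]].

(** Either path may be empty, which leaves its cop idle. [link C P P'] is vacuous when [P] has fewer
    than two vertices or [P'] is empty. *)
Record territory C P1 P2 : Prop := Territory {
  terr_conn : conn e C;
  terr_sorted1 : sorted e P1;
  terr_sorted2 : sorted e P2;
  terr_uniq1 : uniq P1;
  terr_uniq2 : uniq P2;
  terr_out1 : forall u, u \in P1 -> u \notin C;
  terr_out2 : forall u, u \in P2 -> u \notin C;
  terr_disj : forall u, u \in P1 -> u \notin P2;
  terr_nbr : forall u v, u \in C -> e u v -> [|| v \in C, v \in P1 | v \in P2];
  terr_link1 : link C P1 P2;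
  terr_link2 : link C P2 P1 }.

Lemma territory_sym C P1 P2 : territory C P1 P2 -> territory C P2 P1.
Proof.
case=> cC so1 so2 u1 u2 o1 o2 d nb l1 l2; split=> //.
  by move=> u uP2; apply/negP => /d; rewrite uP2.
by move=> u v uC euv; have := nb u v uC euv; rewrite [X in _ || X]orbC.
Qed.

Lemma territory_rev C P1 P2 : territory C P1 P2 -> territory C (rev P1) P2.
Proof.
case=> cC so1 so2 u1 u2 o1 o2 d nb l1 l2; split=> //.
- rewrite rev_sorted; rewrite (@eq_sorted _ _ e) // => x y; exact: e_sym.
- by rewrite rev_uniq.
- by move=> u; rewrite mem_rev; apply: o1.
- by move=> u; rewrite mem_rev; apply: d.
- by move=> u v uC euv; rewrite mem_rev; apply: nb euv.
- move=> nP2 x m y rP1; have [|W [c s dW ax ay]] := l1 nP2 y (rev m) x.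
    by rewrite -[P1]revK rP1 rev_cons rev_rcons rcons_cons.
  by exists W; split=> // u /dW; rewrite mem_rev.
- move=> nP1 x m y rP1; have [||W [c s dW ax ay]] := l2 _ x m y => //.
    by apply: contraNneq nP1 => ->.
  by exists W; split=> // u; rewrite mem_rev; apply: s.
Qed.

Definition attached C v := [exists u in C, e u v].

(** An end [z] that does not touch [C] moves into the witness [W]: [W] touches [z], and [z] touches
    the next vertex, which is the new end. *)
Lemma territory_behead C z P1 P2 : ~~ attached C z ->
  territory C (z :: P1) P2 -> territory C P1 P2.
Proof.
move=> nz [cC so1 so2 u1 u2 o1 o2 d nb l1 l2]; split=> //.
- exact: path_sorted so1.
- by case/andP: u1.
- by move=> u uP1; apply: o1; rewrite inE uP1 orbT.
- by move=> u uP1; apply: d; rewrite inE uP1 orbT.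
- move=> u v uC euv; have := nb u v uC euv; rewrite inE.
  by have [vz|//] := eqVneq v z; case/existsP: nz; exists u; rewrite uC -vz.
- move=> nP2 x m y P1E; have [|W [c s dW az ay]] := l1 nP2 z (x :: m) y; first by rewrite P1E.
  exists ([set z] :|: W); split=> //.
  + by apply: connU => //; [exact: conn1 | exact: adj_sym].
  + by move=> u /s uW; rewrite inE uW orbT.
  + move=> u; rewrite !inE => /orP[/eqP->|/dW[-> ]]; last by rewrite inE negb_or => /andP[].
    by rewrite o1 ?mem_head //; case/andP: u1.
  + exists z, x; rewrite !inE !eqxx; split=> //.
    by move: so1; rewrite P1E => /andP[].
  + by apply: adjS ay; rewrite ?subsetUr.
- move=> nP1 x m y P2E; have [W [c s dW az ay]] := l2 isT x m y P2E.
  by exists W; split=> // u uP1; apply: s; rewrite inE uP1 orbT.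
Qed.

(** Unattached ends are dropped one by one, those on the right by reversing the path. *)
Lemma territory_trim C P1 P2 : territory C P1 P2 ->
  exists P, [/\ territory C P P2, {subset P <= P1} &
    [\/ P = [::], exists2 x, P = [:: x] & attached C x
      | exists x m y, [/\ P = x :: rcons m y, attached C x & attached C y]]].
Proof.
have [n] := ubnP (size P1); elim: n P1 => // n IHn [|x p] le_n tC.
  by exists [::]; split=> //; constructor 1.
have [ax|nax] := boolP (attached C x); last first.
  have [P [tP sP hP]] := IHn p le_n (territory_behead nax tC).
  by exists P; split=> // u /sP uP; rewrite inE uP orbT.
case/lastP: p le_n tC => [|m y] le_n tC.
  by exists [:: x]; split=> //; constructor 2; exists x.
have [ay|nay] := boolP (attached C y).
  by exists (x :: rcons m y); split=> //; constructor 3; exists x, m, y.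
have [||P [tP sP hP]] := IHn (x :: m); first by move: le_n => /=; rewrite size_rcons.
  rewrite -[x :: m]revK; apply: territory_rev; apply: (territory_behead nay).
  by rewrite -rev_rcons; apply: territory_rev.
by exists P; split=> // u /sP; rewrite !inE mem_rcons inE => /orP[->|->]; rewrite ?orbT.
Qed.

(** Breadth-first levels in [C], starting from the neighbours of [x], project the robber onto a
    shortest path [Q]: level n goes to the n-th vertex, levels beyond the end of [Q] to its last
    vertex. One step changes the level by at most one, so the image moves at most one step along
    [Q]. *)
Lemma geodesic C x y : conn e C -> attached C x -> attached C y ->
  exists Q (d : T -> nat), [/\ Q != [::], path e x (rcons Q y), uniq Q & {subset Q <= C}] /\
   [/\ forall r, r \in C -> d r < size Q,
       forall r r', r \in C -> r' \in C -> e r r' -> d r' <= (d r).+1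
     & guard C (fun r => nth x Q (d r)) (x :: rcons Q y)].
Proof.
move=> cC /existsP[a0 /andP[a0C a0x]] /existsP[b0 /andP[b0C b0y]].
(* [lev n] collects the ends of walks of length n in [C] that start at a neighbour of [x]; [d] will
   be the least such n. *)
pose lev := fix lev n : {set T} :=
  if n is n'.+1 then [set v in C | [exists u in lev n', e u v]] else [set u in C | e u x].
have levC n u : u \in lev n -> u \in C by case: n => [|n] /=; rewrite inE => /andP[].
have lev_step n u v : u \in lev n -> v \in C -> e u v -> v \in lev n.+1.
  by move=> un vC euv; rewrite /= inE vC; apply/existsP; exists u; rewrite un.
have [d dP] : exists d : T -> nat, forall r, r \in C -> r \in lev (d r) /\
    forall n, r \in lev n -> d r <= n.
  apply: (@fin_all_exists T (fun=> nat) (fun r n => r \in C -> r \in lev n /\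
    forall n', r \in lev n' -> n <= n')) => r.
  have [rC|_] := boolP (r \in C); last by exists 0.
  have ex : exists n, r \in lev n.
    have /connectP[p] := cC a0 r a0C rC.
    have : a0 \in lev 0 by rewrite /= inE a0C.
    elim: p (0) (a0) => [|v p IHp] n a /= an; first by move=> _ ->; exists n.
    by move=> /andP[/and3P[_ vC eav]]; apply: (IHp n.+1); exact: lev_step eav.
  by exists (ex_minn ex); case: ex_minnP.
have d_lip r r' : r \in C -> r' \in C -> e r r' -> d r' <= (d r).+1.
  move=> rC r'C err'; have [_ h] := dP r' r'C; apply: h.
  by have [h _] := dP r rC; exact: lev_step err'.
have d0 r : r \in C -> e r x -> d r = 0.
  by move=> rC erx; have [_ h] := dP r rC; apply/eqP; rewrite -leqn0 h //= inE rC.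
(* The levels along the path are 0, ..., n, so its vertices are distinct and each has its index as
   level. *)
have mkQ n r : r \in C -> d r = n -> exists Q,
    [/\ path e x Q, last x Q = r, {subset Q <= C} & map d Q = iota 0 n.+1].
  elim: n r => [|n IHn] r rC drn.
    have [h _] := dP r rC; move: h; rewrite drn /= inE rC /= => erx.
    exists [:: r]; rewrite /= e_sym erx drn; split=> //.
    by move=> u; rewrite inE => /eqP->.
  have [h _] := dP r rC; move: h; rewrite drn /= inE rC /= => /existsP[u /andP[un eur]].
  have uC := levC _ _ un; have [_ /(_ _ un) dun] := dP u uC.
  have dur := d_lip u r uC rC eur.
  have [|Q [pQ lQ sQ mQ]] := IHn u uC; first by lia.
  exists (rcons Q r); rewrite rcons_path pQ lQ eur last_rcons map_rcons mQ drn; split=> //.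
    by move=> v; rewrite mem_rcons inE => /orP[/eqP->//|/sQ].
  by rewrite -cats1 -(iotaD 0 n.+1 1) addn1.
(* With [b] of least level, every neighbour of [y] in [C] is projected to the last vertex [b] of
   [Q], from which [y] can be reached. *)
have [b [bC eby] bmin] : exists2 b, b \in C /\ e b y &
    forall r, r \in C -> e r y -> d b <= d r.
  pose B u := (u \in C) && e u y; have b0B : B b0 by apply/andP.
  case: (arg_minnP d b0B) => b /andP[bC eby] bm; exists b => // r rC ery.
  by apply: bm; apply/andP.
have [Q [pQ lQ sQ mQ]] := mkQ (d b) b bC erefl.
have szQ : size Q = (d b).+1 by rewrite -(size_map d) mQ size_iota.
have dQ i : i < size Q -> d (nth x Q i) = i.
  by move=> iQ; rewrite -(nth_map _ 0) // mQ nth_iota // -szQ.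
have eQ i j : i < size Q -> j < size Q -> i <= j.+1 -> j <= i.+1 -> e (nth x Q i) (nth x Q j).
  have eQ1 k : k.+1 < size Q -> e (nth x Q k) (nth x Q k.+1).
    by move=> kQ; apply: (pathP x pQ k.+1 kQ).
  move=> iQ jQ ij ji; have [ltij|ltji|->] := ltngtP i j; last exact: e_refl.
    by have -> : j = i.+1; [lia|apply: eQ1; lia].
  by rewrite e_sym; have -> : i = j.+1; [lia|apply: eQ1; lia].
have minn_lip m n k : m <= n.+1 -> minn m k <= (minn n k).+1 by clear; lia.
have minQ n : minn n (d b) < size Q by rewrite szQ ltnS geq_minr.
exists Q, (fun r => minn (d r) (d b)); split; split=> //.
- by rewrite -size_eq0 szQ.
- by rewrite rcons_path pQ lQ.
- by apply: (@map_uniq _ _ d); rewrite mQ iota_uniq.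
- by move=> r r' rC r'C err'; apply: minn_lip; exact: d_lip.
- split.
    move=> r r' rC r'C err'; apply: eQ => //; apply: minn_lip; apply: d_lip => //.
    by rewrite e_sym.
  move=> r p rC; rewrite inE mem_rcons inE => /or3P[/eqP->|/eqP->|pQ'] erp.
  + rewrite (d0 r rC erp) min0n.
    have /(pathP x)/(_ 0) := pQ; rewrite szQ => /(_ isT) /=; by rewrite e_sym.
  + have -> : minn (d r) (d b) = d b by apply/minn_idPr; exact: bmin.
    by have := nth_last x Q; rewrite szQ /= => ->; rewrite lQ.
  (* A vertex [p] of [Q] is its own image, so the image of a neighbour of [p] is adjacent to [p]. *)
  + have iQ : index p Q < size Q by rewrite index_mem.
    have := dQ _ iQ; rewrite nth_index // => dp; have pC := sQ _ pQ'.
    have dpb : minn (index p Q) (d b) = index p Q by apply/minn_idPl; rewrite -ltnS -szQ.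
    have -> : p = nth x Q (minn (d p) (d b)) by rewrite dp dpb nth_index.
    by apply: eQ => //; apply: minn_lip; apply: d_lip => //; rewrite e_sym.
Qed.

End Territory.

(** * Cutting a territory along a new path *)

Section Split.
Variables (T : finType) (e : rel T).
Hypotheses (e_sym : symmetric e) (e_refl : reflexive e).
Hypothesis no_K33 : K33_minor_free e.
Implicit Types (C D W : {set T}) (P Q : seq T) (x y r : T).

(** The properties of a component of [C] minus [Q] from which the new territories are built. *)
Record subterritory C Q D : Prop := Subterritory {
  sub_conn : conn e D;
  sub_sub : D \subset C;
  sub_out : forall u, u \in D -> u \notin Q;
  sub_closed : forall u v, u \in D -> e u v -> v \in C -> (v \in D) || (v \in Q) }.

Lemma subterritory_component C Q r : r \in C -> r \notin Q ->
  subterritory C Q (component e (C :\: [set u in Q]) r).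
Proof.
move=> rC rQ; have rCQ : r \in C :\: [set u in Q] by rewrite !inE rQ.
have sub := component_sub e rCQ.
split; first exact: component_conn.
- exact: subset_trans sub (subsetDl _ _).
- by move=> u /(subsetP sub); rewrite !inE => /andP[].
- move=> u v uD euv vC; have [|vQ] := boolP (v \in Q); first by rewrite orbT.
  by rewrite (component_closed rCQ uD) // !inE vQ.
Qed.

Lemma path_ends x Q y : Q != [::] -> path e x (rcons Q y) ->
  [/\ adj e [set u in Q] [set x], adj e [set u in Q] [set y] & conn e [set u in Q]].
Proof.
case: Q => // q Q _ /=; rewrite rcons_path => /and3P[exq pQ elq]; split.
- by exists q, x; rewrite !inE !eqxx e_sym.
- by exists (last q Q), y; split=> //; [rewrite inE mem_last|exact: set11].
- exact: conn_path.
Qed.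

(** The path [Q] takes the place of the empty [P2]; both links are vacuous, as [P1] and [Q] have at
    most one vertex. *)
Lemma territory_small C P1 P2 Q D : territory e C P1 P2 -> subterritory C Q D ->
    Q != [::] -> uniq Q -> sorted e Q -> {subset Q <= C} ->
    size P1 <= 1 -> P2 = [::] -> size Q <= 1 ->
  territory e D P1 Q.
Proof.
move=> [cC so1 so2 u1 u2 o1 o2 d nb l1 l2] [cD sD oD clD] Q0 uQ soQ sQ szP1 P2E szQ.
split=> //.
- by move=> u /o1; apply: contraNN; apply: (subsetP sD).
- by move=> u uQ'; apply/negP => /oD; rewrite uQ'.
- by move=> u /o1; apply: contraNN; apply: sQ.
- move=> u v uD euv; have := nb u v (subsetP sD _ uD) euv.
  rewrite P2E orbF => /orP[vC|->]; last by rewrite orbT.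
  by have := clD u v uD euv vC => /orP[->|->]; rewrite ?orbT.
- by move=> _ x m y P1E; move: szP1; rewrite P1E /= size_rcons.
- by move=> _ x m y QE; move: szQ; rewrite QE /= size_rcons.
Qed.

(** Guarding [Q] with its ends covers both old paths, so the second path becomes empty and the links
    vacuous. *)
Lemma territory_merge C x y Q D : territory e C [:: x] [:: y] -> subterritory C Q D ->
    path e x (rcons Q y) -> uniq Q -> {subset Q <= C} ->
  territory e D (x :: rcons Q y) [::].
Proof.
move=> [cC so1 so2 u1 u2 o1 o2 d nb l1 l2] [cD sD oD clD] pQ uQ sQ.
have [xC yC] : x \notin C /\ y \notin C by rewrite o1 ?o2 ?mem_head.
have xy : x != y by have := d x (mem_head _ _); rewrite inE.
split=> //.
- rewrite /= rcons_uniq uQ mem_rcons inE negb_or xy /= andbT.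
  by apply/andP; split; [apply: contraNN xC|apply: contraNN yC]; exact: sQ.
- move=> u; rewrite inE mem_rcons inE => /or3P[/eqP->|/eqP->|uQ'].
  + by apply: contraNN xC; exact: (subsetP sD).
  + by apply: contraNN yC; exact: (subsetP sD).
  + by apply/negP => /oD; rewrite uQ'.
- move=> u v uD euv; have := nb u v (subsetP sD _ uD) euv.
  rewrite !inE mem_rcons inE => /or3P[vC|->|->]; rewrite ?orbT //.
  by have := clD u v uD euv vC => /orP[->|->]; rewrite ?orbT.
Qed.

(** If [D] does not touch [P2], then [P1] and [Q] suffice. Otherwise the excluded minor keeps [D]
    away from the interior [m] of [P1], so [Q] with its ends replaces [P1]. *)
Lemma territory_split C x m y P2 Q D : let P1 := x :: rcons m y in
    territory e C P1 P2 -> subterritory C Q D -> D != set0 ->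
    Q != [::] -> path e x (rcons Q y) -> uniq Q -> {subset Q <= C} ->
  territory e D P1 Q \/ territory e D (x :: rcons Q y) P2.
Proof.
move=> P1 [cC so1 so2 u1 u2 o1 o2 d nb l1 l2] subD D0 Q0 pQ uQ sQ.
have [cD sD oD clD] := subD; have sD' := subsetP sD.
have [Qx Qy cQ] := path_ends Q0 pQ.
have soQ : sorted e Q.
  by move: pQ; rewrite rcons_path; case: (Q) => // q Q' /andP[/= /andP[]].
have [xP1 yP1] : x \in P1 /\ y \in P1 by split; rewrite /P1 inE ?eqxx // mem_rcons mem_head orbT.
have [xC yC] : x \notin C /\ y \notin C by rewrite !o1.
have mP1 u : u \in m -> u \in P1 by move=> um; rewrite /P1 !inE mem_rcons inE um !orbT.
have [xm xy ym um] : [/\ x \notin m, x != y, y \notin m & uniq m].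
  by move: u1; rewrite /= rcons_uniq mem_rcons inE negb_or => /and3P[/andP[? ?] ? ?].
have cP1 : conn e [set u in P1] by exact: conn_path.
have [/existsP[p /andP[pP2 /existsP[u0 /andP[u0D eu0p]]]]|nP2] :=
    boolP [exists p in P2, attached e D p]; last first.
  (* Each path witnesses the link of the other: [Q] touches both ends of [P1], and [P1] both ends of
     [Q]. *)
  left; split=> //.
  - by move=> u /o1; apply: contraNN; exact: sD'.
  - by move=> u uQ'; apply/negP => /oD; rewrite uQ'.
  - by move=> u /o1; apply: contraNN; exact: sQ.
  - move=> u v uD euv; have /or3P[vC|->|vP2] := nb u v (sD' _ uD) euv.
    + by have := clD u v uD euv vC => /orP[->|->]; rewrite ?orbT.
    + by rewrite orbT.
    + by case/existsP: nP2; exists v; rewrite vP2; apply/existsP; exists u; rewrite uD.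
  - move=> _ x' m' y' P1E; move: (P1E) => [<- /rcons_inj[_ <-]].
    exists [set u in Q]; split=> // u; rewrite inE //.
    move=> uQ'; split; first by apply/negP => /oD; rewrite uQ'.
    by apply: contraL (sQ _ uQ') => /o1.
  - move=> _ q' m' q QE; exists [set u in P1]; split=> //.
    + by move=> u; rewrite in_set.
    + move=> u; rewrite in_set => /o1 uC; split; first by apply: contraNN uC; exact: sD'.
      by apply: contraNN uC; exact: sQ.
    + by exists x, q'; rewrite [x \in _]inE [q' \in _]inE; move: pQ; rewrite QE => /andP[].
    + exists y, q; rewrite [y \in _]inE [q \in _]inE; split=> //.
      by move: pQ; rewrite QE rcons_path -rcons_cons last_rcons e_sym => /andP[].
have P20 : P2 != [::] by apply: contraTneq pP2 => ->.
have [W [cW sW dW Wx Wy]] := l1 P20 x m y erefl.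
(* [Q] lies in [C] but off [D], so some edge inside [C] leaves [D], and it can only lead to [Q]. *)
have DQ : adj e D [set u in Q].
  have [|u [v [uD /setDP[vC vD] euv]]] := conn_exit cC sD D0.
    have [q qQ] : exists q, q \in Q by case: (Q) Q0 => // q ? _; exists q; rewrite mem_head.
    by apply/subsetPn; exists q; [exact: sQ|apply: contraL qQ => /oD].
  by exists u, v; rewrite inE; have := clD u v uD euv vC; rewrite (negPf vD).
(* The K33 is formed by the interior of P1, Q and W against D, x and y. *)
have nm u v : u \in D -> v \in m -> ~~ e u v.
  move=> uD vm; apply/negP => euv.
  have m0 : m != [::] by case: (m) vm.
  have [mx my cm] := path_ends m0 so1.
  have D_W : adj e W D by exists p, u0; rewrite sW // u0D e_sym.
  have dis (A B : {set T}) : (forall u, u \in A -> u \notin B) -> [disjoint A & B].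
    by move=> h; apply/pred0P => z /=; apply/negP => /andP[/h/negP].
  have := @no_K33 (nth set0 [:: [set u in m]; [set u in Q]; W])
    (nth set0 [:: D; [set x]; [set y]]).
  apply.
  - by case=> [|[|[|i]]].
  - by case=> [|[|[|i]]] // _; exact: conn1.
  - case=> [|[|[|i]]] //= [|[|[|k]]] //= _ _.
    + by exists v, u; rewrite inE e_sym.
    + exact: adj_sym.
  - move=> i k /andP[ik k3]; move: k k3 i ik.
    case=> [|[|[|k]]] // _ [|[|[|i]]] //= _; apply: dis => z; rewrite !inE.
    + by move=> /mP1/o1; apply: contraNN; exact: sQ.
    + by move=> zm; apply/negP => /dW[_]; rewrite mP1.
    + by move=> /sQ zC; apply/negP => /dW[]; rewrite zC.
  - move=> i k /andP[ik k3]; move: k k3 i ik.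
    case=> [|[|[|k]]] // _ [|[|[|i]]] //= _; apply: dis => z; rewrite !inE //.
    + by move=> /sD' zC; apply: contraNneq xC => <-.
    + by move=> /sD' zC; apply: contraNneq yC => <-.
    + by move=> /eqP->.
  - case=> [|[|[|i]]] // [|[|[|k]]] //= _ _; apply: dis => z; rewrite ?inE.
    + by move=> /mP1/o1; apply: contraNN; exact: sD'.
    + by move=> zm; apply: contraNneq xm => <-.
    + by move=> zm; apply: contraNneq ym => <-.
    + by move=> zQ; apply/negP => /oD; rewrite zQ.
    + by move=> /sQ zC; apply: contraNneq xC => <-.
    + by move=> /sQ zC; apply: contraNneq yC => <-.
    + by move=> /dW[zC _]; apply: contraNN zC; exact: sD'.
    + by move=> /dW[_ zP]; apply: contraNneq zP => ->.
    + by move=> /dW[_ zP]; apply: contraNneq zP => ->.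
right.
have inQ' u : u \in x :: rcons Q y -> u \in P1 \/ u \in Q.
  by rewrite inE mem_rcons inE => /or3P[/eqP->|/eqP->|]; [left|left|right].
split=> //.
- rewrite /= rcons_uniq uQ mem_rcons inE negb_or xy /= andbT.
  by apply/andP; split; [apply: contraNN xC|apply: contraNN yC]; exact: sQ.
- move=> u /inQ'[/o1|uQ']; first by apply: contraNN; exact: sD'.
  by apply/negP => /oD; rewrite uQ'.
- by move=> u /o2; apply: contraNN; exact: sD'.
- by move=> u /inQ'[/d//|/sQ]; apply: contraL => /o2.
- move=> u v uD euv; rewrite !inE mem_rcons inE.
  have := nb u v (sD' _ uD) euv; rewrite !inE mem_rcons inE => /orP[vC|].
    by have := clD u v uD euv vC => /orP[->|->]; rewrite ?orbT.
  move=> /orP[/or3P[->|->|vm]|->]; rewrite ?orbT //.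
  by have := nm u v uD vm; rewrite euv.
(* [W] avoids [P1] and [C], hence the new path, whose ends are again [x] and [y]. *)
- move=> _ x' m' y' P1E; move: (P1E) => [<- /rcons_inj[_ <-]].
  exists W; split=> // u uW; have [uC uP1] := dW u uW.
  split; first by apply: contraNN uC; exact: sD'.
  by apply/negP => /inQ'[|/sQ]; [exact/negP|exact/negP].
- move=> _ x2 m2 y2 P2E; have [W2 [cW2 sW2 dW2 W2x W2y]] := l2 isT x2 m2 y2 P2E.
  (* [W2] contains [P1], in particular [x], to which [Q] is attached. *)
  exists (W2 :|: [set u in Q]); split.
  + apply: connU => //; apply: adj_sym => //.
    by apply: adjS Qx => //; rewrite sub1set; exact: sW2.
  + move=> u /inQ'[/sW2 uW|uQ']; rewrite !inE ?uW ?uQ' ?orbT //.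
  + move=> u; rewrite !inE => /orP[/dW2[uC ->]|uQ'].
      by split=> //; apply: contraNN uC; exact: sD'.
    split; first by apply/negP => /oD; rewrite uQ'.
    by apply: contraL (sQ _ uQ') => /o2.
  + by apply: adjS W2x => //; exact: subsetUl.
  + by apply: adjS W2y => //; exact: subsetUl.
Qed.

End Split.

(** * Capture *)

Section Chase.
Variables (k : nat) (T : finType) (e : rel T).
Hypotheses (e_sym : symmetric e) (e_refl : reflexive e).
Variables (C : {set T}) (P1 P2 : seq T) (s1 s2 : T -> T) (i1 i2 i3 : 'I_k).
Hypotheses (i12 : i1 != i2) (i31 : i3 != i1) (i32 : i3 != i2).
Hypotheses (g1 : guard e C s1 P1) (g2 : guard e C s2 P2).
Hypothesis nbr : forall u v, u \in C -> e u v -> [|| v \in C, v \in P1 | v \in P2].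
Implicit Types (c : {ffun 'I_k -> T}) (r x : T).

Definition shadowed c r := e (c i1) (s1 r) && e (c i2) (s2 r).

(** Cops [i1] and [i2] step onto their shadows while [i3] moves freely to [x]. A robber who leaves
    [C] enters a guarded path and is struck in the next round, whence the condition [0 < n]. *)
Lemma shadow_round n c r x : 0 < n -> r \in C -> shadowed c r -> e (c i3) x ->
    (forall c' r', r' \in C -> e r r' -> shadowed c' r' -> c' i3 = x -> win e n c' r') ->
  win e n.+1 c r.
Proof.
move=> n0 rC /andP[c1 c2] c3 wn.
pose c' : {ffun 'I_k -> T} := [ffun i => if i == i1 then s1 r else if i == i2 then s2 r
   else if i == i3 then x else c i].
have [c'1 c'2 c'3] : [/\ c' i1 = s1 r, c' i2 = s2 r & c' i3 = x].
  by rewrite !ffunE !eqxx eq_sym (negPf i12) (negPf i31) (negPf i32).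
apply: (win_step (c' := c')) => [i|r' err'].
  by rewrite ffunE; case: eqP => [->|_] //; case: eqP => [->|_] //; case: eqP => [->|_].
have /or3P[r'C|r'P|r'P] := nbr rC err'.
- by apply: wn => //; rewrite /shadowed c'1 c'2 (proj1 g1) ?(proj1 g2).
- by apply: (@win_strike _ _ _ e_refl _ _ _ i1) => //; rewrite c'1 (proj2 g1).
- by apply: (@win_strike _ _ _ e_refl _ _ _ i2) => //; rewrite c'2 (proj2 g2).
Qed.

Variables (q : nat -> T) (m : nat) (d : T -> nat) (n0 : nat).
Hypotheses (q_step : forall j, j < m -> e (q j) (q j.+1)).
Hypotheses (d_le : forall r, r \in C -> d r <= m).
Hypotheses (d_lip : forall r r', r \in C -> r' \in C -> e r r' -> d r' <= (d r).+1).
Hypotheses (n0_gt0 : 0 < n0).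
(** The takeover: [i3] has reached the image of [r], and the robber has answered by moving to
    [r']. *)
Hypothesis win_caught_up : forall c r r', r \in C -> r' \in C -> e r r' ->
  shadowed c r' -> c i3 = q (d r) -> win e n0 c r'.

(* Cop i3 walks along q towards the image q (d r) of the robber, starting from the end 0, *)
(* so that the image stays ahead of him until he reaches it. *)
Lemma chase f j c r : r \in C -> shadowed c r -> c i3 = q j -> j <= m ->
  j <= (d r).+1 -> m < f + j -> win e (f + n0) c r.
Proof.
elim: f j c r => [|f IHf] j c r rC sc cj jm jd mf; first by lia.
(* Given [j <= (d r).+1], the image is now at most one step away and is reached at once; otherwise
   it is at least two steps ahead, and still not behind after the next moves of both players. *)
rewrite addSn; have [dj|jd'] := leqP (d r) j.+1.
  apply: (@shadow_round _ _ _ (q (d r))) => //; first by rewrite addn_gt0 n0_gt0 orbT.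
    rewrite cj; have [jd'|jd'|->] := ltngtP j (d r); last exact: e_refl.
      have -> : d r = j.+1 by lia.
      by apply: q_step; have := d_le rC; lia.
    have -> : j = (d r).+1 by lia.
    by rewrite e_sym; apply: q_step; lia.
  move=> c' r' r'C err' sc' c'3; apply: (@win_leq _ _ _ n0); first exact: leq_addl.
  exact: win_caught_up err' sc' c'3.
have dm := d_le rC.
apply: (@shadow_round _ _ _ (q j.+1)) => //; first by rewrite addn_gt0 n0_gt0 orbT.
  by rewrite cj; apply: q_step; lia.
move=> c' r' r'C err' sc' c'3; apply: (IHf j.+1) => //; first by lia.
  by have := d_lip r'C rC; rewrite e_sym => /(_ err'); lia.
by lia.
Qed.

Lemma travel p c r : r \in C -> shadowed c r ->
  path e (c i3) p -> last (c i3) p = q 0 -> win e (size p + (m.+1 + n0)) c r.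
Proof.
elim: p c r => [|x p IHp] c r rC sc /=.
  by move=> _ c0; apply: (@chase m.+1 0) => //; rewrite addn0.
move=> /andP[cx px] lx; rewrite addSn; apply: (@shadow_round _ _ _ x) => //.
  by rewrite !addn_gt0 n0_gt0 !orbT.
by move=> c' r' r'C err' sc' c'x; apply: IHp; rewrite ?c'x.
Qed.

End Chase.

(** Travelling to the new path of [l] vertices takes [p] rounds and chasing the image [l] rounds.
    Since [l] is positive, D + l is at most (D + 1) l, the share of the vertices removed from the
    territory. *)
Lemma round_budget D n l p : 0 < l -> l <= n -> p <= D ->
  p + (l.-1.+1 + ((D + 1) * (n - l) + 1)) <= (D + 1) * n + 1.
Proof. nia. Qed.

(** * Induction on the size of the territory *)

Section Capture.
Variables (T : finType) (e : rel T) (D : nat).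
Hypotheses (e_sym : symmetric e) (e_refl : reflexive e).
Hypothesis e_diam : forall x y, exists p, [/\ path e x p, last x p = y & size p <= D].
Hypothesis no_K33 : K33_minor_free e.
Implicit Types (C : {set T}) (P Q : seq T) (c : {ffun 'I_3 -> T}) (r x : T).

(** The extra round leaves time to strike a robber who steps onto a guarded path, even when no
    territory remains. *)
Definition capturable C : Prop := forall P1 P2 s1 s2 (i1 i2 : 'I_3) c r,
  territory e C P1 P2 -> guard e C s1 P1 -> guard e C s2 P2 -> i1 != i2 -> r \in C ->
  e (c i1) (s1 r) -> e (c i2) (s2 r) -> win e ((D + 1) * #|C| + 1) c r.

(* The third cop takes over the new path Q, which with its ends forms Qx; then the cop whose *)
(* path no longer touches the territory is released. *)
Lemma capturable_extend C P1 P2 s1 s2 (i1 i2 : 'I_3) c r Q Qx x d :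
  (forall C', #|C'| < #|C| -> capturable C') ->
  territory e C P1 P2 -> guard e C s1 P1 -> guard e C s2 P2 -> i1 != i2 -> r \in C ->
  e (c i1) (s1 r) -> e (c i2) (s2 r) ->
  Q != [::] -> uniq Q -> sorted e Q -> {subset Q <= C} -> {subset Q <= Qx} ->
  (forall r, r \in C -> d r < size Q) ->
  (forall r r', r \in C -> r' \in C -> e r r' -> d r' <= (d r).+1) ->
  guard e C (fun r => nth x Q (d r)) Qx ->
  (forall C', C' != set0 -> subterritory e C Q C' -> exists P1' P2', territory e C' P1' P2' /\
     ({subset P1' <= P1} /\ {subset P2' <= Qx} \/ {subset P1' <= Qx} /\ {subset P2' <= P2})) ->
  win e ((D + 1) * #|C| + 1) c r.
Proof.
move=> IH tC g1 g2 i12 rC c1 c2 Q0 uQ soQ sQ sQx dQ d_lip g3 next.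
have [i3 [i31 i32]] : exists i3 : 'I_3, i3 != i1 /\ i3 != i2.
  have : 0 < #|~: [set i1; i2]| by rewrite cardsCs setCK cards2 i12 card_ord.
  by case/card_gt0P => i3; rewrite !inE negb_or => /andP[]; exists i3.
have szQ : 0 < size Q by rewrite lt0n size_eq0.
have cardQ : size Q <= #|C|.
  by rewrite -(card_uniqP uQ); apply: subset_leq_card; apply/subsetP.
have [p [pp lp szp]] := e_diam (c i3) (nth x Q 0).
(* The rounds reserved for play after [Q] is taken over, when at most [#|C| - size Q] vertices
   remain to the robber. *)
pose n0 := (D + 1) * (#|C| - size Q) + 1.
apply: (@win_leq _ _ _ (size p + ((size Q).-1.+1 + n0))); first exact: round_budget.
apply: (@travel _ _ _ e_sym e_refl C P1 P2 s1 s2 i1 i2 i3 _ _ _ g1 g2 (terr_nbr tC)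
  (nth x Q) _ d) => //.
- by move=> j jQ; have /(sortedP x) := soQ; apply; rewrite -ltn_predRL.
- by move=> u /dQ dQu; rewrite -ltnS prednK.
- by rewrite /n0 addn1.
- move=> {c1 c2 pp lp r rC}c r0 r r0C rC er0r /andP[c1 c2] c3.
  have [rQ|rQ] := boolP (r \in Q).
    apply: (@win_strike _ _ _ e_refl _ _ _ i3); first by rewrite /n0 addn1.
    by rewrite c3; apply: (proj2 g3) => //; exact: sQx.
  have sub := subterritory_component e_sym rC rQ; set C' := component e _ r in sub.
  have rC' : r \in C' by exact: component_refl.
  have c3' : e (c i3) (nth x Q (d r)) by rewrite c3; exact: (proj1 g3).
  have C'C : C' \subset C :\: [set u in Q] by apply: component_sub; rewrite !inE rQ.
  have cardC' : #|C'| <= #|C| - size Q.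
    apply: leq_trans (subset_leq_card C'C) _; rewrite cardsD.
    have /setIidPr -> : [set u in Q] \subset C by apply/subsetP => u; rewrite inE; exact: sQ.
    by rewrite cardsE (card_uniqP uQ).
  have ltC' : #|C'| < #|C|.
    by apply: leq_ltn_trans cardC' _; rewrite ltn_subrL szQ (leq_trans szQ).
  have [|P1' [P2' [tC' sub']]] := next C' _ sub; first by apply/set0Pn; exists r.
  have C'sub := sub_sub sub.
  apply: (@win_leq _ _ _ ((D + 1) * #|C'| + 1)); first by rewrite leq_add2r leq_mul2l cardC' orbT.
  (* Cop [i3] guards [Q] from now on; [i2] is released in the first case, [i1] in the second. *)
  case: sub' => [[s1' s2']|[s1' s2']].
    apply: (IH C' ltC' P1' P2' s1 (fun r => nth x Q (d r)) i1 i3) => //; last by rewrite eq_sym.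
    - exact: guardS g1.
    - exact: guardS g3.
  apply: (IH C' ltC' P1' P2' (fun r => nth x Q (d r)) s2 i3 i2) => //.
  - exact: guardS g3.
  - exact: guardS g2.
by rewrite /shadowed c1.
Qed.

(** After trimming, a path with two attached ends is cut off by a geodesic between them ([long]),
    and two single vertices are joined by a geodesic. Otherwise one path is empty and the other has
    at most one vertex ([small]). *)
Lemma capture C : capturable C.
Proof.
have [n] := ubnP #|C|; elim: n C => // n IHn C le_n P1 P2 s1 s2 i1 i2 c r.
have {IHn le_n} IH C' : #|C'| < #|C| -> capturable C'.
  by move=> lt; apply: IHn; lia.
move=> tC g1 g2 i12 rC c1 c2.
have guardP P P' s : {subset P' <= P} -> guard e C s P -> guard e C s P' by exact: guardS.
have [P1' [{}tC sP1 hP1]] := territory_trim e_sym tC.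
have {sP1} g1 := guardP _ _ _ sP1 g1.
have [P2' [/territory_sym {}tC sP2 hP2]] := territory_trim e_sym (territory_sym tC).
have {sP2} g2 := guardP _ _ _ sP2 g2.
have sortedQ x y Q : path e x (rcons Q y) -> sorted e Q.
  by rewrite rcons_path; case: Q => // z Q /andP[/= /andP[]].
have subQ x y Q : {subset Q <= x :: rcons Q y}.
  by move=> u uQ; rewrite inE mem_rcons inE uQ !orbT.
have long x m y P s s' j j' : territory e C (x :: rcons m y) P ->
    attached e C x -> attached e C y ->
    guard e C s (x :: rcons m y) -> guard e C s' P -> j != j' ->
    e (c j) (s r) -> e (c j') (s' r) -> win e ((D + 1) * #|C| + 1) c r.
  move=> tP ax ay gs gs' jj' cj cj'.
  have [Q [d [[Q0 pQ uQ sQ] [dQ d_lip gQ]]]] := geodesic e_sym e_refl (terr_conn tP) ax ay.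
  apply: (@capturable_extend C _ _ s s' j j' c r Q _ x d IH tP gs gs' jj' rC cj cj') gQ _ => //.
    exact: sortedQ pQ.
  move=> C' C'0 sub.
  have [t|t] := territory_split e_sym no_K33 tP sub C'0 Q0 pQ uQ sQ.
    by exists (x :: rcons m y), Q; split=> //; left; split.
  by exists (x :: rcons Q y), P; split=> //; right; split.
have small P s s' j j' : territory e C P [::] -> size P <= 1 ->
    guard e C s P -> guard e C s' [::] -> j != j' ->
    e (c j) (s r) -> e (c j') (s' r) -> win e ((D + 1) * #|C| + 1) c r.
  move=> tP szP gs gs' jj' cj cj'.
  (* The idle third cop takes over a single vertex of [C], namely the present position of the
     robber; the projection is constant. *)
  apply: (@capturable_extend C _ _ s s' j j' c r [:: r] [:: r] r (fun=> 0)
    IH tP gs gs' jj' rC cj cj') => //.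
  - by move=> u; rewrite inE => /eqP->.
  - by split=> [u v _ _ _|u v _]; rewrite ?inE // => /eqP->.
  - move=> C' _ sub; exists P, [:: r]; split; last by left; split.
    by apply: territory_small tP sub _ _ _ _ _ _ _ => // u; rewrite inE => /eqP->.
case: hP1 => [P1E|[x P1E ax]|[x [m [y [P1E ax ay]]]]].
- case: hP2 => [P2E|[y P2E ay]|[y [m [z [P2E ay az]]]]].
  + by subst; apply: small tC _ g1 g2 i12 c1 c2.
  + by subst; rewrite eq_sym in i12; apply: small (territory_sym tC) _ g2 g1 i12 c2 c1.
  + by subst; rewrite eq_sym in i12; apply: long (territory_sym tC) ay az g2 g1 i12 c2 c1.
- case: hP2 => [P2E|[y P2E ay]|[y [m [z [P2E ay az]]]]].
  + by subst; apply: small tC _ g1 g2 i12 c1 c2.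
  + subst; have [Q [d [[Q0 pQ uQ sQ] [dQ d_lip gQ]]]] := geodesic e_sym e_refl (terr_conn tC) ax ay.
    apply: (@capturable_extend C _ _ s1 s2 i1 i2 c r Q _ x d IH tC g1 g2 i12 rC c1 c2) gQ _ => //.
      exact: sortedQ pQ.
    move=> C' C'0 sub; exists (x :: rcons Q y), [::]; split; last by right; split.
    exact: territory_merge tC sub pQ uQ sQ.
  + by subst; rewrite eq_sym in i12; apply: long (territory_sym tC) ay az g2 g1 i12 c2 c1.
- by subst; apply: long tC ax ay g1 g2 i12 c1 c2.
Qed.

(** All cops start at [q], which as a path of one vertex bounds the component of the robber. That
    component misses [q], and this absorbs the extra round of [capturable]. *)
Lemma three_cops_win (q : T) r : win e ((D + 1) * #|T|) ([ffun=> q] : {ffun 'I_3 -> T}) r.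
Proof.
have [<-|rq] := eqVneq r q.
  apply: (@win_leq _ _ _ 0) => //.
  by apply/orP; left; apply/existsP; exists ord0; rewrite ffunE.
set A := [set: T] :\: [set u in [:: q]].
have rA : r \in A by rewrite !inE rq.
have sub := subterritory_component e_sym (in_setT r) (_ : r \notin [:: q]).
have {}sub := sub (ltac:(by rewrite inE)).
set C := component e _ r in sub.
have CA : C \subset A by exact: component_sub.
have qC : q \notin C by apply: contraTN isT => /(subsetP CA); rewrite !inE eqxx.
have ltC : #|C| < #|T|.
  have : C \proper [set: T] by apply/properP; split; [exact: subsetT|exists q].
  by move/proper_card; rewrite cardsT.
apply: (@win_leq _ _ _ ((D + 1) * #|C| + 1)); first by nia.
apply: (@capture C [:: q] [::] (fun=> q) (fun=> q) ord0 ord_max) => //; rewrite ?ffunE //.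
- split=> //.
  + exact: sub_conn sub.
  + by move=> u; rewrite inE => /eqP->.
  + by move=> u v uC euv; rewrite orbF; exact: (sub_closed sub uC euv (in_setT v)).
- by split=> [u v _ _ _|u v _] //; rewrite inE => /eqP->.
- exact: (component_refl e A r).
Qed.

End Capture.

Lemma walk_le_diam (T : finType) (e : rel T) x y : connect e x y ->
  exists p, [/\ path e x p, last x p = y & size p <= diam e].
Proof.
move=> /connectP[p0 pp0 ->]; case/shortenP: pp0 => p pp up _ {p0}.
(* A walk without repetitions is short enough for the search defining [dist] to succeed. *)
have szp : size p < #|T| by have := max_card (mem (x :: p)); rewrite (card_uniqP up).
have : has (has_walk e x (last x p)) (iota 0 #|T|).
  apply/hasP; exists (size p); first by rewrite mem_iota.
  by apply/existsP; exists (in_tuple p); rewrite pp eqxx.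
move=> hw; have := nth_find 0 hw; rewrite nth_iota; last by rewrite has_find size_iota in hw.
rewrite add0n => /existsP[t /andP[pt /eqP lt]]; exists t; split=> //.
rewrite size_tuple -[find _ _]/(dist e x (last x p)).
apply: leq_trans (leq_bigmax_cond (F := fun y => dist e x y) (last x p) isT) _.
exact: (leq_bigmax_cond (F := fun x => \max_y dist e x y) x isT).
Qed.

(** * Planar graphs have no K33 minor *)

Section Turning.
Variable R : realDomainType.
Implicit Types (p q u v w : R * R).
Local Open Scope ring_scope.

(** The open upper half plane with the positive horizontal axis added, so that it contains exactly
    one of w and -w for nonzero w. *)
Definition above w : bool := (0 < w.2) || ((w.2 == 0) && (0 < w.1)).

(* Close vectors w and w' lie on either side of the positive horizontal axis. *)
Definition cross_ray w w' : bool := (above w != above w') && (0 < w.1).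

Definition near_pts (eta : R) p q : bool :=
  (`|p.1 - q.1| < eta) && (`|p.2 - q.2| < eta).

(** The factor 4 leaves a margin: moving both points by less than [eta] changes each coordinate of
    their difference by less than [2 * eta]. *)
Definition far_pts (eta : R) p q : bool := ~~ near_pts (4 * eta) p q.

Lemma aboveP w :
  reflect (0 < w.2 \/ w.2 = 0 /\ 0 < w.1) (above w).
Proof.
apply: (iffP orP) => [[->|/andP[/eqP-> ->]]|[->|[/eqP-> ->]]]; by [left | right].
Qed.

Lemma aboveN p q : p != q -> above (p - q) = ~~ above (q - p).
Proof.
case: p q => [a b] [a' b']; rewrite xpair_eqE => ne.
have {}ne : a - a' <> 0 \/ b - b' <> 0.
  have [eqa|/eqP nea] := eqVneq (a - a') 0; last by left.
  right; move=> eqb; move: ne; rewrite -subr_eq0 eqa -(subr_eq0 b) eqb eqxx; by [].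
apply/idP/idP.
  move=> /aboveP /= h; apply/aboveP => /= h'; lra.
move=> /aboveP /= h; apply/aboveP => /=.
case: (ltrgtP (b - b') 0) => hb; [exfalso | by left | right; split=> //].
  apply: h; left; lra.
case: (ltrgtP (a - a') 0) => ha //; [exfalso; apply: h; right; lra|lra].
Qed.

Lemma near_refl (eta : R) p : 0 < eta -> near_pts eta p p.
Proof. by move=> h; rewrite /near_pts !subrr normr0 h. Qed.

(** Some coordinate of a - b is at least [4 * eta] in absolute value, and the other three
    differences are within [2 * eta] of a - b. So all four lie in one of the upper, lower, right and
    left half planes. *)
Lemma square_cases (eta : R) (a a' b b' : R * R) :
    near_pts eta a a' -> near_pts eta b b' ->
    far_pts eta a b ->
  [\/ [/\ above (a - b) = above (a' - b), above (a - b) = above (a - b')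
        & above (a - b) = above (a' - b')],
      [/\ 0 < (a - b).1, 0 < (a' - b).1, 0 < (a - b').1 & 0 < (a' - b').1] |
      [/\ (a - b).1 < 0, (a' - b).1 < 0, (a - b').1 < 0 & (a' - b').1 < 0]].
Proof.
case: a a' b b' => [a1 a2] [a1' a2'] [b1 b2] [b1' b2'].
rewrite /far_pts /near_pts /= !ltr_norml.
move=> /andP[/andP[? ?] /andP[? ?]] /andP[/andP[? ?] /andP[? ?]] fab.
have farP x y : ~~ ((- (4 * eta) < x < 4 * eta) && (- (4 * eta) < y < 4 * eta)) ->
    [\/ x <= - (4 * eta), 4 * eta <= x, y <= - (4 * eta) | 4 * eta <= y].
  rewrite !negb_and -!leNgt => /orP[/orP[]|/orP[]] ?;
  by [constructor 1|constructor 2|constructor 3|constructor 4].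
have ab x y : 0 < y -> above (x, y) by move=> h; apply/aboveP; left.
have nab x y : y < 0 -> ~~ above (x, y).
  by move=> h; apply/aboveP => /= -[|[]] *; lra.
have [h|h] := ltP (2 * eta) (a2 - b2).
  by constructor 1; rewrite !ab //=; lra.
have [h'|h'] := ltP (a2 - b2) (- (2 * eta)).
  by constructor 1; rewrite !(negbTE (nab _ _ _)) //=; lra.
by case: (farP _ _ fab) => ?; [constructor 3|constructor 2|exfalso|exfalso];
  rewrite /=; (try split); lra.
Qed.

(** The four differences form a small closed polygon that does not wind around the origin, so it
    crosses the positive axis an even number of times. *)
Lemma cross_ray_square (eta : R) (a a' b b' : R * R) :
    near_pts eta a a' -> near_pts eta b b' ->
    far_pts eta a b ->
  cross_ray (a - b) (a' - b) (+) cross_ray (a - b') (a' - b') =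
  cross_ray (a - b) (a - b') (+) cross_ray (a' - b) (a' - b').
Proof.
move=> na nb fab; rewrite /cross_ray.
case: (square_cases na nb fab) => [[<- <- <-]|[-> -> -> _]|[h1 h2 h3 _]].
- by rewrite eqxx.
- by do 4 case: (above _).
- by rewrite !ltNge !ltW //= !andbF.
Qed.

(** Reflection exchanges the positive and negative horizontal half axes, and crossing either of them
    is exactly a change of [above]. *)
Lemma cross_rayN (eta : R) p q v : 
    0 < eta -> near_pts eta p q -> far_pts eta p v -> far_pts eta q v ->
  cross_ray (v - p) (v - q) = cross_ray (p - v) (q - v) (+) above (p - v) (+) above (q - v).
Proof.
move=> eta0 npq fp fq.
have nq u : far_pts eta u v -> above (v - u) = ~~ above (u - v).
  move=> fuv; apply: aboveN; apply: contraNneq fuv => ->.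
  by apply: near_refl; rewrite mulr_gt0.
rewrite /cross_ray !nq //.
have opp1 u : (v - u).1 = - (u - v).1 by rewrite -opprB.
rewrite opp1 oppr_gt0.
case: (square_cases npq (near_refl v eta0) fp) => [[<- _ _]|[h1 _ _ _]|[h1 _ _ _]].
- by rewrite !eqxx; case: (above _).
- rewrite h1 [_ < 0]ltNge ltW //=; by do 2 case: (above _).
- rewrite h1 [0 < _]ltNge ltW //=; by do 2 case: (above _).
Qed.

(* The turning number modulo 2 of the polygon p :: s around v; opp_turn is that of the *)
(* image of the polygon under the point reflection in v. *)
Fixpoint turn v p (s : seq (R * R)) : bool :=
  if s is q :: s' then cross_ray (p - v) (q - v) (+) turn v q s' else false.

Fixpoint opp_turn v p (s : seq (R * R)) : bool :=
  if s is q :: s' then cross_ray (v - p) (v - q) (+) opp_turn v q s' else false.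

Lemma opp_turnE (eta : R) v p s : 0 < eta -> path (near_pts eta) p s ->
    all (fun q => far_pts eta q v) (p :: s) ->
  opp_turn v p s = turn v p s (+) above (p - v) (+) above (last p s - v).
Proof.
move=> eta0; elim: s p => [|q s IHs] p /=; first by rewrite addbb.
move=> /andP[npq pqs] /and3P[fp fq fs].
rewrite (cross_rayN eta0 npq fp fq) IHs //= ?fq //.
case: (cross_ray _ _); case: (above (p - v)); case: (above (q - v)); case: (turn _ _ _);
  by case: (above _).
Qed.

(** [cross_ray_square] is summed over the grid of all pairs of steps; inner sides cancel modulo 2
    and the boundary of the product remains. *)
Lemma turn_rect (eta : R) a s b t :
    path (near_pts eta) a s -> path (near_pts eta) b t ->
    allrel (far_pts eta) (a :: s) (b :: t) ->
  turn b a s (+) turn (last b t) a s = opp_turn a b t (+) opp_turn (last a s) b t.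
Proof.
elim: s a => [|a' s IHs] a /=; first by rewrite addbb.
move=> /andP[naa' pa's] pbt; rewrite !allrel_consl => /and3P[fa fa' fs].
(* One step of the first polygon against the whole second polygon. *)
have strip : cross_ray (a - b) (a' - b) (+) cross_ray (a - last b t) (a' - last b t) =
             opp_turn a b t (+) opp_turn a' b t.
  elim: t b {IHs fs} pbt fa fa' => [|b' t IHt] b /=; first by rewrite addbb.
  move=> /andP[nbb' pb't] /and3P[fab fab' fat] /and3P[fa'b fa'b' fa't].
  have /= := IHt b' pb't; rewrite fab' fat fa'b' fa't => /(_ isT isT).
  have := cross_ray_square naa' nbb' fab.
  move: (cross_ray (a - b) _) (cross_ray (a - b') _) (cross_ray (a - last b' t) _)
    (cross_ray (a - b) _) (cross_ray (a' - b) _)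
    (opp_turn a b' t) (opp_turn a' b' t).
  by do 7 case.
have := IHs a' pa's pbt; rewrite allrel_consl fa' fs => /(_ isT).
move: strip.
case: (cross_ray _ _) (cross_ray _ _) (turn _ _ _) (turn _ _ _)
  (opp_turn _ _ _) (opp_turn _ _ _) (opp_turn _ _ _).
all: by do 6 case.
Qed.

End Turning.

(** * The parity obstruction for K33 *)

(** In the sum of the 18 relations, every [da], [db], [hab] and [hba] occurs twice and every [haa]
    six times. Each [hbb j l] occurs three times, and the pairs [hbb j l], [hbb l j] contribute 9 in
    all, which is odd. *)
Lemma k33_parity (da db : nat -> nat -> nat -> bool)
    (haa hab hba hbb : nat -> nat -> bool) :
    (forall i k j l, i < k < 3 -> j < 3 -> l < 3 -> j != l ->
       da i j k (+) db i j l (+) da k l i (+) db k l j =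
       haa i k (+) hab i l (+) hba k j (+) hbb j l) ->
    (forall j l, j < 3 -> l < 3 -> j != l -> hbb l j = ~~ hbb j l) ->
  False.
Proof.
move=> rect anti.
have xorK (x y u v : bool) : x = y -> u = v -> x (+) u = y (+) v by move=> -> ->.
have := xorK _ _ _ _ (rect 0 1 0 1 isT isT isT isT) (xorK _ _ _ _ (rect 0 1 0 2 isT isT isT isT)
 (xorK _ _ _ _ (rect 0 1 1 2 isT isT isT isT)  (xorK _ _ _ _ (rect 0 1 1 0 isT isT isT isT)
 (xorK _ _ _ _ (rect 0 1 2 0 isT isT isT isT)  (rect 0 1 2 1 isT isT isT isT))))).
have := xorK _ _ _ _ (rect 0 2 0 1 isT isT isT isT) (xorK _ _ _ _ (rect 0 2 0 2 isT isT isT isT)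
 (xorK _ _ _ _ (rect 0 2 1 2 isT isT isT isT)  (xorK _ _ _ _ (rect 0 2 1 0 isT isT isT isT)
 (xorK _ _ _ _ (rect 0 2 2 0 isT isT isT isT)  (rect 0 2 2 1 isT isT isT isT))))).
have := xorK _ _ _ _ (rect 1 2 0 1 isT isT isT isT) (xorK _ _ _ _ (rect 1 2 0 2 isT isT isT isT)
 (xorK _ _ _ _ (rect 1 2 1 2 isT isT isT isT)  (xorK _ _ _ _ (rect 1 2 1 0 isT isT isT isT)
 (xorK _ _ _ _ (rect 1 2 2 0 isT isT isT isT)  (rect 1 2 2 1 isT isT isT isT))))).
rewrite (anti 0 1 isT isT isT) (anti 0 2 isT isT isT) (anti 1 2 isT isT isT).
move=> e1 e2; move/(xorK _ _ _ _ e1)/(xorK _ _ _ _ e2).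
clear. 
have xorE b c : b (+) c = xorb b c by case: b; case: c.
rewrite !xorE.
set lhs := (X in X = _); set rhs := (X in _ = X) => lr.
(* The two sides of the summed relation differ for all values of the variables. *)
have : xorb lhs rhs = true.
  rewrite /lhs /rhs {lr lhs rhs}.
  btauto.
by rewrite lr; case: (rhs).
Qed.

(* This is the van Kampen obstruction: summed over the 18 pairs of independent edges, the *)
(* identity turn_rect reads 0 = 1 modulo 2. *)
Lemma k33_chains (R : realDomainType) (eta : R) (a b : nat -> R * R)
    (L : nat -> nat -> seq (R * R)) : (0 < eta)%R ->
    (forall i j, i < 3 -> j < 3 ->
       path (near_pts eta) (a i) (L i j) /\ last (a i) (L i j) = b j) ->
    (forall i j k l, i < k < 3 -> j < 3 -> l < 3 -> j != l ->
       allrel (far_pts eta) (a i :: L i j) (a k :: L k l)) ->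
    (forall j l, j < 3 -> l < 3 -> j != l -> b j <> b l) ->
  False.
Proof.
move=> eta0 nearL farL b_inj.
apply: (@k33_parity (fun i j k => turn (a k) (a i) (L i j))
  (fun i j l => turn (b l) (a i) (L i j)) (fun i k => above (a k - a i)%R)
  (fun i l => above (b l - a i)%R) (fun k j => above (a k - b j)%R)
  (fun j l => above (b l - b j)%R)) => [i k j l /andP[ik k3] j3 l3 jl|j l j3 l3 jl]; last first.
  by apply: aboveN; apply/eqP; apply: b_inj.
have i3 := ltn_trans ik k3.
have [nij lij] := nearL i j i3 j3; have [nkl lkl] := nearL k l k3 l3.
have farij : allrel (far_pts eta) (a i :: L i j) (a k :: L k l) by apply: farL; rewrite ?ik.
have far_sym p q : far_pts eta p q = far_pts eta q p.
  by rewrite /far_pts /near_pts !(distrC p.1) !(distrC p.2).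
have fara p : p \in a i :: L i j -> all (fun q => far_pts eta q p) (a k :: L k l).
  move=> pi; apply/allP => q qk; rewrite far_sym; exact: (allrelP farij).
(* [opp_turnE] turns the right-hand side into turns of the second chain and the four [above] terms
   at the end points. *)
have := turn_rect nij nkl farij.
rewrite (opp_turnE eta0 nkl (fara _ (mem_head _ _)))
  (opp_turnE eta0 nkl (fara _ (mem_last _ _))) lij lkl.
move: (turn _ _ _) (turn _ _ _)  (turn _ _ _)  (turn _ _ _) (above _) (above _) (above _) (above _).
by do 8 case.
Qed.

From mathcomp Require Import all_classical all_reals all_analysis.
Import numFieldNormedType.Exports.

(** * From planar drawings to fine polygons *)

Section Chains.
Variable R : realType.
Local Open Scope classical_set_scope.
Local Open Scope ring_scope.

Lemma near_pts_trans (d1 d2 : R) (p q r : R * R) :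
  near_pts d1 p q -> near_pts d2 q r -> near_pts (d1 + d2) p r.
Proof.
by rewrite /near_pts !ltr_norml => /andP[/andP[? ?] /andP[? ?]] /andP[/andP[? ?] /andP[? ?]];
  apply/andP; split; lra.
Qed.

Lemma near_pts_sym (d : R) (p q : R * R) : near_pts d p q = near_pts d q p.
Proof. by rewrite /near_pts (distrC p.1) (distrC p.2). Qed.

Lemma near_ptsW (d1 d2 : R) (p q : R * R) :
  d1 <= d2 -> near_pts d1 p q -> near_pts d2 p q.
Proof.
by move=> d12 /andP[h1 h2]; rewrite /near_pts (lt_le_trans h1) ?(lt_le_trans h2).
Qed.

Lemma within_near_pts (g : R -> R * R) (s eta : R) : 0 < eta ->
    {within `[0, 1], continuous g} -> `[0, 1]%classic s ->
  exists2 r, 0 < r &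
    forall t, `[0, 1]%classic t -> `|s - t| < r -> near_pts eta (g s) (g t).
Proof.
move=> eta0 /subspace_continuousP/(_ s) + s01; move=> /(_ s01).
move=> /cvg_ballP/(_ _ eta0); rewrite near_withinE => /nbhs_ballP[r r0 hr].
exists r => // t t01 st; have [] := hr t st t01.
by rewrite /near_pts /ball /= => -> ->.
Qed.

(** Near each pair (s, t), a third of a distance separating [g s] from [g' t] works by the triangle
    inequality; compactness of the square of parameters makes this uniform. *)
Lemma curves_separated (g g' : R -> R * R) :
    {within `[0, 1], continuous g} -> {within `[0, 1], continuous g'} ->
    (forall s t, `[0, 1]%classic s -> `[0, 1]%classic t -> g s <> g' t) ->
  exists2 d, 0 < d &
    forall s t, `[0, 1]%classic s -> `[0, 1]%classic t -> ~~ near_pts d (g s) (g' t).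
Proof.
move=> cg cg' gg'.
have cpt : compact (`[0, 1]%classic `*` `[0, 1]%classic : set (R * R)).
  by apply: compact_setX; exact: segment_compact.
have /compact_near_coveringP cov := cpt.
have : \forall d \near (0 : R)^'+, `[0, 1]%classic `*` `[0, 1]%classic `<=`
    (fun z : R * R => `[0, 1]%classic z.1 -> `[0, 1]%classic z.2 -> ~~ near_pts d (g z.1) (g' z.2)).
  apply: cov => -[s t] [/= s01 t01].
  have [d d0 nd] : exists2 d, 0 < d & ~~ near_pts d (g s) (g' t).
    have : (g s).1 <> (g' t).1 \/ (g s).2 <> (g' t).2.
      have := gg' s t s01 t01; case: (g s) (g' t) => [a b] [a' b'] /= ne.
      by have [eqa|/eqP nea] := eqVneq a a'; [right=> eqb; apply: ne; rewrite eqa eqb | left].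
    case=> [/eqP|/eqP]; rewrite -subr_eq0 -normr_gt0 => h; eexists; try exact: h;
    by rewrite /near_pts ltxx ?andbF.
  have d30 : 0 < d / 3 by lra.
  have [r r0 hr] := within_near_pts d30 cg s01.
  have [r' r'0 hr'] := within_near_pts d30 cg' t01.
  exists (ball s r `*` ball t r', [set eps | eps < d / 3]) => /=.
    split; last by apply: nbhs_right_lt.
    by exists (ball s r, ball t r') => //=; split; apply: nbhsx_ballx.
  move=> [[z1 z2] eps] /= [[sz1 tz2] epsd] z101 z201.
  apply: contraNN nd => h.
  have h1 := hr z1 z101 sz1; have := hr' z2 z201 tz2; rewrite near_pts_sym => h2.
  by apply: near_ptsW (near_pts_trans (near_pts_trans h1 h) h2); lra.
move=> /(filterI (nbhs_right_gt 0))/filter_ex[d [d0 hd]].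
by exists d => // s t s01 t01; exact: (hd (s, t)).
Qed.

(** The Heine-Cantor theorem, proved by covering the compact interval. *)
Lemma curve_uniform (g : R -> R * R) (eta : R) : 0 < eta ->
    {within `[0, 1], continuous g} ->
  exists2 d, 0 < d & forall s t, `[0, 1]%classic s -> `[0, 1]%classic t ->
    `|s - t| < d -> near_pts eta (g s) (g t).
Proof.
move=> eta0 cg; have /compact_near_coveringP cov := @segment_compact R 0 1.
have : \forall d \near (0 : R)^'+, `[0, 1]%classic `<=`
    (fun s => forall t, `[0, 1]%classic s -> `[0, 1]%classic t ->
       `|s - t| < d -> near_pts eta (g s) (g t)).
  apply: cov => s s01.
  have eta20 : 0 < eta / 2 by lra.
  have [r r0 hr] := within_near_pts eta20 cg s01.
  have r20 : 0 < r / 2 by lra.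
  exists (ball s (r / 2), [set eps | eps < r / 2]) => /=.
    by split; [exact: nbhsx_ballx | apply: nbhs_right_lt].
  move=> [s' eps] /= [ss' epsr] t s'01 t01 s't.
  have h1 : near_pts (eta / 2) (g s) (g s') by apply: hr => //; apply: lt_trans ss' _; lra.
  have h2 : near_pts (eta / 2) (g s) (g t).
    apply: hr => //; apply: le_lt_trans (ler_distD s' _ _) _.
    by rewrite /ball /= in ss'; lra.
  rewrite near_pts_sym in h1; apply: near_ptsW (near_pts_trans h1 h2); lra.
move=> /(filterI (nbhs_right_gt 0))/filter_ex[d [d0 hd]].
by exists d => // s t s01 t01; exact: (hd s).
Qed.


(** Samples the curve at the multiples of 1 / (N + 1), a mesh finer than the modulus of uniform
    continuity. *)
Lemma curve_chain (g : R -> R * R) (eta : R) : 0 < eta ->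
    {within `[0, 1], continuous g} ->
  exists c : seq (R * R),
    [/\ path (near_pts eta) (g 0) c, last (g 0) c = g 1
      & forall p, p \in g 0 :: c -> exists2 s, `[0, 1]%classic s & p = g s].
Proof.
move=> eta0 cg; have [d d0 hd] := curve_uniform eta0 cg.
have [N] : exists N : nat, d^-1 < N.+1%:R.
  exists (Num.truncn d^-1); exact: truncnS_gt.
move=> dN.
pose f k := g (k%:R / N.+1%:R).
have N0 : 0 < N.+1%:R :> R by rewrite ltr0n.
have f01 k : (k <= N.+1)%N -> `[0, 1]%classic (k%:R / N.+1%:R : R).
  by move=> kN; rewrite /= in_itv /= divr_ge0 //= ler_pdivrMr // mul1r ler_nat.
exists [seq f k | k <- iota 1 N.+1].
have f0 : g 0 = f 0%N by rewrite /f mul0r.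
rewrite f0; split.
- apply/(pathP (f 0%N)) => i; rewrite size_map size_iota => iN; have iN' := ltnW iN.
  rewrite -map_cons -[_ :: _]/(iota 0 N.+2) !(nth_map 0%N) ?size_iota //.
  rewrite !nth_iota // ?add0n ?add1n.
  apply: hd; [exact: f01 (ltnW _)|exact: f01|].
  rewrite distrC -mulrBl -natrB // subSnn mul1r.
  by rewrite ger0_norm ?invr_ge0 ?ltW // invf_plt // posrE.
- rewrite last_map -nth_last size_iota nth_iota //= /f.
  by rewrite add1n divff ?gt_eqF.
- move=> p; rewrite -map_cons => /mapP[k]; rewrite -[_ :: _]/(iota 0 N.+2) mem_iota => kN ->.
  by exists (k%:R / N.+1%:R) => //; exact: f01.
Qed.

(** Finitely many pairs of edges without common ends occur, so one [eta] keeps all their polygons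
    apart. Loops, which carry no curve, are drawn as constant curves. *)
Lemma planar_chains (T : finType) (e : rel T) : planar R e ->
  exists (pos : T -> R * R) (eta : R) (chain : T -> T -> seq (R * R)),
    [/\ injective pos, 0 < eta,
        forall u v, e u v -> path (near_pts eta) (pos u) (chain u v) /\
          last (pos u) (chain u v) = pos v
      & forall u v x y, e u v -> e x y -> ~~ has (mem [:: u; v]) [:: x; y] ->
          allrel (far_pts eta) (pos u :: chain u v) (pos x :: chain x y)].
Proof.
case=> pos [curve [pos_inj _ arc vert cross]].
have [g gP] : {g : T * T -> R -> R * R & forall uv, e uv.1 uv.2 ->
    [/\ {within `[0, 1], continuous (g uv)}, g uv 0 = pos uv.1, g uv 1 = pos uv.2 &
     forall s, `[0, 1]%classic s ->
       if uv.1 == uv.2 then g uv s = pos uv.1 else curve uv.1 uv.2 (g uv s)]}.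
  apply: (@choice _ _ (fun uv (f : R -> R * R) => e uv.1 uv.2 ->
    [/\ {within `[0, 1], continuous f}, f 0 = pos uv.1, f 1 = pos uv.2 &
     forall s, `[0, 1]%classic s ->
       if uv.1 == uv.2 then f s = pos uv.1 else curve uv.1 uv.2 (f s)])) => -[u v] /=.
  have [<-|uv] := eqVneq u v.
    by exists (fun=> pos u) => _; split=> //; apply: continuous_subspaceT => x; exact: cvg_cst.
  have [euv|neuv] := boolP (e u v); last by exists (fun=> pos u).
  have [f [cf _ f0 f1 ->]] := arc u v euv uv.
  by exists f => _; split=> // s s01; exists s.
pose sep (q : (T * T) * (T * T)) :=
  [&& e q.1.1 q.1.2, e q.2.1 q.2.2 & ~~ has (mem [:: q.1.1; q.1.2]) [:: q.2.1; q.2.2]].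
have [d dP] : {d : (T * T) * (T * T) -> R & forall q, 0 < d q /\ (sep q ->
    forall s t, `[0, 1]%classic s -> `[0, 1]%classic t ->
      ~~ near_pts (d q) (g q.1 s) (g q.2 t))}.
  apply: (@choice _ _ (fun q (d : R) => 0 < d /\ (sep q ->
    forall s t, `[0, 1]%classic s -> `[0, 1]%classic t ->
      ~~ near_pts d (g q.1 s) (g q.2 t)))) => -[[u v] [x y]].
  have [/and3P[/= euv exy]|_] := boolP (sep _); last by exists 1; rewrite ltr01.
  rewrite orbF !inE => nxy.
  have [/= cg _ _ gs] := gP (u, v) euv; have [/= cg' _ _ gs'] := gP (x, y) exy.
  have [|d d0 hd] := curves_separated cg cg'; last by exists d; split.
  move=> s t s01 t01 gst; move: (gs s s01) (gs' t t01); rewrite -gst.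
  (* A common point contradicts, in turn, injectivity of [pos], the absence of other vertices on an
     edge (twice), and the absence of crossings. *)
  have [uv|uv] := eqVneq u v; have [xy|xy] := eqVneq x y.
  - by move=> -> /pos_inj ux; move: nxy; rewrite ux eqxx.
  - move=> -> /(vert _ _ _ exy xy); rewrite !inE => /orP[]/eqP ux;
    by move: nxy; rewrite ux eqxx ?orbT.
  - move=> + gx; rewrite gx => /(vert _ _ _ euv uv); rewrite !inE => ux.
    by move: nxy; rewrite ux.
  - move=> h1 h2; have [|w [w1 w2 _]] := cross u v x y euv uv exy xy _ _ h1 h2.
      apply/negP => /perm_mem/(_ x); rewrite !inE eqxx /= => ux.
      by move: nxy; rewrite ux.
    move: w1 w2 nxy; rewrite !inE => + /orP[]/eqP <-; by move=> ->; rewrite ?orbT.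
(* The division by 4 matches the factor in [far_pts]. *)
pose eta := \big[Num.min/1]_q (d q / 4).
have eta0 : 0 < eta.
  apply: (big_ind (fun x => 0 < x)) => // [x y x0 y0|q _]; first by rewrite lt_min x0.
  by have [d0 _] := dP q; lra.
have eta_le q : 4 * eta <= d q.
  have : eta <= d q / 4 by exact: bigmin_le.
  lra.
have [chain cP] : {chain : T * T -> seq (R * R) & forall uv, e uv.1 uv.2 ->
   [/\ path (near_pts eta) (g uv 0) (chain uv), last (g uv 0) (chain uv) = g uv 1
      & forall p, p \in g uv 0 :: chain uv -> exists2 s, `[0, 1]%classic s & p = g uv s]}.
  apply: (@choice _ _ (fun uv (c : seq (R * R)) => e uv.1 uv.2 ->
   [/\ path (near_pts eta) (g uv 0) c, last (g uv 0) c = g uv 1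
      & forall p, p \in g uv 0 :: c -> exists2 s, `[0, 1]%classic s & p = g uv s])) => uv.
  have [euv|_] := boolP (e uv.1 uv.2); last by exists [::].
  have [cg _ _ _] := gP uv euv.
  by have [c hc] := curve_chain eta0 cg; exists c.
exists pos, eta, (fun u v => chain (u, v)); split=> // [u v euv|u v x y euv exy nxy].
  have [/= _ g0 g1 _] := gP (u, v) euv; have [/= p1 p2 _] := cP (u, v) euv.
  by move: p1 p2; rewrite g0 g1.
have [/= _ g0 _ _] := gP (u, v) euv; have [/= _ g0' _ _] := gP (x, y) exy.
have [/= _ _ c1] := cP (u, v) euv; have [/= _ _ c2] := cP (x, y) exy.
apply/allrelP => p q; rewrite -g0 -g0' => /c1[s s01 ->] /c2[t t01 ->].
have [_ /= h] := dP ((u, v), (x, y)).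
apply: contraNN (h _ s t s01 t01); first exact: near_ptsW.
by apply/and3P.
Qed.

End Chains.

(** * Drawing a K33 minor by polygons *)

Section NoK33.
Variables (R : realType) (T : finType) (e : rel T).
Hypotheses (e_sym : symmetric e) (e_refl : reflexive e) (e_planar : planar R e).

(** Each of the nine edges of the minor becomes a walk inside [A i :|: B j], drawn by joining the
    chains of its edges. Walks with both indices different have no vertex in common, so their
    polygons are far apart. *)
Lemma planar_no_K33 : K33_minor_free e.
Proof.
move=> A B cA cB AB dA dB dAB.
have {}dB j l : j < 3 -> l < 3 -> j != l -> [disjoint B j & B l].
  move=> j3 l3; rewrite neq_ltn => /orP[jl|lj]; first by apply: dB; rewrite jl.
  by rewrite disjoint_sym; apply: dB; rewrite lj.
have [x0 _] := AB 0 0 isT isT.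
have [a aP] : {a : nat -> T & forall i, i < 3 -> a i \in A i}.
  apply: (@choice _ _ (fun i x => i < 3 -> x \in A i)) => i.
  have [i3|_] := boolP (i < 3); last by exists x0.
  by have [x [y []]] := AB i 0 i3 isT; exists x.
have [b bP] : {b : nat -> T & forall i, i < 3 -> b i \in B i}.
  apply: (@choice _ _ (fun i x => i < 3 -> x \in B i)) => i.
  have [i3|_] := boolP (i < 3); last by exists x0.
  by have [x [y []]] := AB 0 i isT i3; exists y.
have [P PP] : {P : nat * nat -> seq T & forall ij, ij.1 < 3 -> ij.2 < 3 ->
    [/\ path e (a ij.1) (P ij), last (a ij.1) (P ij) = b ij.2
      & {subset a ij.1 :: P ij <= A ij.1 :|: B ij.2}]}.
  apply: (@choice _ _ (fun ij p => ij.1 < 3 -> ij.2 < 3 ->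
    [/\ path e (a ij.1) p, last (a ij.1) p = b ij.2
      & {subset a ij.1 :: p <= A ij.1 :|: B ij.2}])) => -[i j] /=.
  have [i3|_] := boolP (i < 3); last by exists [::].
  have [j3|_] := boolP (j < 3); last by exists [::].
  have [p [p1 p2] p3] := conn_walk e_sym (cA _ i3) (cB _ j3) (AB _ _ i3 j3) (aP _ i3) (bP _ j3).
  by exists p.
have [pos [eta [chain [pos_inj eta0 near_chain far_chain]]]] := planar_chains e_planar.
pose pts := fix pts u (s : seq T) := if s is v :: s' then chain u v ++ pts v s' else [::].
have ptsP u s : path e u s -> path (near_pts eta) (pos u) (pts u s) /\
    last (pos u) (pts u s) = pos (last u s).
  elim: s u => [|v s IHs] u //= /andP[euv pvs].
  have [c1 c2] := near_chain _ _ euv.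
  by rewrite cat_path last_cat c1 c2; exact: IHs.
have pts_edge u s p : path e u s -> p \in pos u :: pts u s ->
    exists x y, [/\ x \in u :: s, y \in u :: s, e x y & p \in pos x :: chain x y].
  elim: s u => [|v s IHs] u /=.
    (* A walk without edges is covered by the loop at its vertex. *)
    by move=> _; rewrite inE => /eqP->; exists u, u; rewrite !mem_head.
  move=> /andP[euv pvs]; rewrite inE mem_cat orbA -in_cons => /orP[pin|pin].
    by exists u, v; rewrite !inE !eqxx !orbT.
  have [|x [y [xs ys exy pxy]]] := IHs v pvs; first by rewrite inE pin orbT.
  by exists x, y; split=> //; rewrite inE ?xs ?ys orbT.
apply: (@k33_chains R eta (pos \o a) (pos \o b) (fun i j => pts (a i) (P (i, j)))) => //=.
- move=> i j i3 j3; have [/= w1 w2 _] := PP (i, j) i3 j3.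
  by have [h1 h2] := ptsP _ _ w1; rewrite h2 w2.
- move=> i j k l /andP[ik k3] j3 l3 jl; have i3 := ltn_trans ik k3.
  have [/= w1 _ w2] := PP (i, j) i3 j3; have [/= w3 _ w4] := PP (k, l) k3 l3.
  apply/allrelP => p q /(pts_edge _ _ _ w1)[x [y [xs ys exy pxy]]].
  move=> /(pts_edge _ _ _ w3)[x' [y' [xs' ys' exy' pxy']]].
  suff dis : ~~ has (mem [:: x; y]) [:: x'; y'].
    by apply: (allrelP (far_chain _ _ _ _ exy exy' dis)).
  have dis u : u \in A k :|: B l -> u \in A i :|: B j -> False.
    have disj (C D : {set T}) : [disjoint C & D] -> u \in C -> u \in D -> False.
      by move=> /pred0P/(_ u) /= + uC uD; rewrite uC uD.
    rewrite !inE => /orP[uk|ul] /orP[ui|uj].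
    - by apply: disj ui uk; rewrite dA ?ik.
    - by apply: disj uk uj; rewrite dAB.
    - by apply: disj ui ul; rewrite dAB.
    - by apply: disj uj ul; rewrite dB.
  apply/hasP => -[u]; rewrite !inE => /orP[]/eqP-> /orP[]/eqP hu.
  + by apply: (dis x); [rewrite -hu|]; [exact: w4| exact: w2].
  + by apply: (dis y); [rewrite -hu|]; [exact: w4| exact: w2].
  + by apply: (dis x); [rewrite -hu|]; [exact: w4| exact: w2].
  + by apply: (dis y); [rewrite -hu|]; [exact: w4| exact: w2].
- move=> j l j3 l3 jl /pos_inj bjl; have /pred0P/(_ (b j)) := dB j l j3 l3 jl.
  by rewrite /= bP // bjl bP.
Qed.

End NoK33.

(** * The capture time *)

(** The least bound achieved by some strategy exists by well-ordering; the existence of a strategy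
    is made boolean classically so that [ex_minn] applies. *)
Lemma is_capt_le (k : nat) (T : finType) (e : rel T) (s : strategy k T) n :
    legal_strategy e s -> captures_within e s n ->
  exists2 m, is_capt k e m & (m <= n)%N.
Proof.
move=> ls cs.
pose P m := `[< exists2 s : strategy k T, legal_strategy e s & captures_within e s m >].
have exP : exists m, P m by exists n; apply/asboolP; exists s.
case: (ex_minnP exP) => m /asboolP Pm minm; exists m; last by apply: minm; apply/asboolP; exists s.
by split=> // s' n' ls' cs'; apply: minm; apply/asboolP; exists s'.
Qed.

Theorem theorem4p3 (R : realType) (T : finType) (e : rel T)
  (e_sym : symmetric e) (e_refl : reflexive e)
  (e_connected : graph_connected e) (e_planar : planar R e) :
  exists2 m : nat, is_capt 3 e m & (m <= (diam e + 1) * #|T|)%N.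
Proof.
have [/card_gt0P[q _] conn_e] := e_connected.
have [s ls cs] := win_strategy e_refl
  (three_cops_win e_sym e_refl (fun x y => walk_le_diam (conn_e x y))
     (planar_no_K33 e_sym e_refl e_planar) q).
exact: is_capt_le ls cs.
Qed.
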